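(* Let $r$ be a rational number that is not an integer. Then there is no positive integer $n$ with $f_r(n)=f_r(n+1)$; that is, for every $x$, the number of positive integers $n\leq x$ with $f_r(n)=f_r(n+1)$ is $0$.
   Context: For a positive integer $n=\prod_{i=1}^k p_i^{a_i}$ (distinct primes $p_i$) and real $r$, $f_r(n)=\sum_{i=1}^k a_i p_i^r$, with $f_r(1)=0$. *)

(* Defs.v *)
From HB Require Import structures.
From mathcomp Require Import all_boot all_order all_algebra.
From mathcomp Require Import reals exp.

Set Implicit Arguments.
Unset Strict Implicit.
Unset Printing Implicit Defensive.

Import Order.TTheory GRing.Theory Num.Theory.

Local Open Scope ring_scope.

Definition f (R : realType) (r : R) (n : nat) : R :=
  \sum_(p <- primes n) (logn p n)%:R * p%:R `^ r.

(* [Num.truncn x] is the floor of x when 0 <= x and 0 when x < 0, so the list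
   below enumerates exactly the positive integers n <= x. *)
Definition count_ties (R : realType) (r x : R) : nat :=
  count (fun n => f r n == f r n.+1) (iota 1 (Num.truncn x)).

(* Main.v *)
(** Write r = a/b. For distinct primes p, q the ratio (p/q)^r is a positive real
    b-th root of a rational, and it is irrational by comparing p-adic
    valuations. Such pairwise incommensurable real radicals are linearly
    independent over the rationals: divide a relation by one of its terms, let
    the resulting radicals act on the rational span of their monomials, and take
    traces. If y > 0 and d > 1 is least with y^d = c rational, then every
    rational factor of X^d - c has constant term +-y^k with k its degree, so
    X^d - c is irreducible, the characteristic polynomial of y is a power of it,
    and the trace of y vanishes; only the term 1 survives. Since n and n + 1 have
    disjoint sets of prime factors, f_r(n) = f_r(n + 1) would be a nontrivial
    relation between the p^r. *)

Require Import Defs.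
From HB Require Import structures.
From mathcomp Require Import all_boot all_order all_algebra all_field.
From mathcomp Require Import boolp reals exp.

Set Implicit Arguments.
Unset Strict Implicit.
Unset Printing Implicit Defensive.

Import Order.TTheory GRing.Theory Num.Theory.

Local Open Scope ring_scope.

(** * Powers of [X^d - c] and traces of matrix radicals *)

Definition is_rat (F : numFieldType) (x : F) : Prop :=
  exists q : rat, x = ratr q.

Definition radical_exponent (F : numFieldType) (y : F) (d : nat) : Prop :=
  [/\ (0 < d)%N, is_rat (y ^+ d) &
      forall k, (0 < k < d)%N -> ~ is_rat (y ^+ k)].

Lemma radical_exponent_exists (F : numFieldType) (y : F) (b : nat) :
  (0 < b)%N -> is_rat (y ^+ b) -> exists d, radical_exponent y d.
Proof.
move=> b0 yb.
have ex : exists d, (0 < d)%N && `[< is_rat (y ^+ d) >].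
  by exists b; rewrite b0; apply/asboolP.
case: (ex_minnP ex) => d /andP[d0 /asboolP yd] dmin.
exists d; split => // k /andP[k0 kd] yk.
have := dmin k; rewrite k0 /= leqNgt kd => H.
by have /H : `[< is_rat (y ^+ k) >] by apply/asboolP.
Qed.

(** The remainder power [y ^+ (n %% d)] is a quotient of the rationals [y ^+ n] and a power of
    [y ^+ d], so minimality of [d] makes the remainder zero. *)
Lemma is_rat_expn_dvd (F : numFieldType) (y : F) (d n : nat) :
  y != 0 -> radical_exponent y d -> is_rat (y ^+ n) -> (d %| n)%N.
Proof.
move=> y0 [d0 [c yd] dmin] [q yn]; rewrite /dvdn; apply/eqP/eqP.
case: posnP => // r0; case: (@dmin (n %% d)%N); first by rewrite r0 ltn_mod.
exists (q / c ^+ (n %/ d)).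
rewrite fmorph_div rmorphXn /= -yn -yd -exprM {2}(divn_eq n d) exprD mulnC.
by rewrite mulrAC divff ?mul1r // expf_neq0.
Qed.

(** Every root has absolute value the positive [d]-th root of [c], and the product of the roots is,
    up to sign, the constant term over the leading coefficient. So [y] to the degree of [g] is
    rational. *)
Lemma dvdn_size_radical_roots (F : realFieldType) (y : F) (d : nat) (c : rat)
    (g : {poly rat}) :
  0 < y -> radical_exponent y d -> y ^+ d = ratr c -> g != 0 ->
  (forall z : algC, root (map_poly ratr g) z -> z ^+ d = ratr c) ->
  (d %| (size g).-1)%N.
Proof.
move=> y0 yd ydc g0 groots.
have [d0 _ _] := yd.
apply: (is_rat_expn_dvd (lt0r_neq0 y0) yd).
have c0 : 0 < c by rewrite -(ltr0q F) -ydc exprn_gt0.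
have [s gE] := closed_field_poly_normal (map_poly (ratr : rat -> algC) g).
rewrite lead_coef_map /= in gE.
have l0 : lead_coef g != 0 by rewrite lead_coef_eq0.
have l0' : ratr (lead_coef g) != 0 :> algC by rewrite fmorph_eq0.
have ss : (size g).-1 = size s.
  rewrite -(size_map_poly (ratr : {rmorphism rat -> algC})) gE.
  by rewrite size_scale // size_prod_XsubC.
rewrite ss.
have zs z : z \in s -> `|z| ^+ d = ratr c.
  move=> zs; rewrite -normrX groots ?gtr0_norm ?ltr0q //.
  by rewrite gE rootZ // root_prod_XsubC.
set t := g.[0] / lead_coef g.
have nE : `|ratr t : algC| ^+ d = ratr c ^+ size s.
  rewrite fmorph_div -horner_map rmorph0 /= gE hornerZ mulrAC divff // mul1r.
  rewrite horner_prod normr_prod -prodrXl.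
  rewrite big_seq (eq_bigr (fun=> ratr c)); last first.
    by move=> z zs'; rewrite hornerXsubC sub0r normrN zs.
  by rewrite -big_seq big_const_seq count_predT iter_mulr_1.
have tr : (ratr t : algC) \is Num.real by apply: Creal_Crat (Crat_rat _).
(* Only rationals pass between [algC] and [F]; squaring removes the norm, so the identity descends
   to [rat]. *)
have tE : (t ^+ 2) ^+ d = (c ^+ size s) ^+ 2.
  apply: (fmorph_inj (ratr : {rmorphism rat -> algC})).
  by rewrite !rmorphXn /= -(real_normK tr) [LHS]exprAC nE.
exists `|t|.
apply/eqP; rewrite -(@eqrXn2 _ d) ?ler0q ?exprn_ge0 ?(ltW y0) //.
rewrite -(@eqrXn2 _ 2) ?exprn_ge0 ?ler0q ?(ltW y0) //.
rewrite [(y ^+ _) ^+ d]exprAC ydc -!rmorphXn /= -tE.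
by rewrite [(`|t| ^+ d) ^+ 2]exprAC real_normK // num_real.
Qed.

(* Applied to the gcd of [g] and [X^d - c], the degree constraint of
   [dvdn_size_radical_roots] forces [X^d - c] to divide [g]. *)
Lemma radical_roots_power (F : realFieldType) (y : F) (d : nat) (c : rat)
    (g : {poly rat}) :
  0 < y -> radical_exponent y d -> y ^+ d = ratr c -> g \is monic ->
  (forall z : algC, root (map_poly ratr g) z -> z ^+ d = ratr c) ->
  exists k, g = ('X^d - c%:P) ^+ k.
Proof.
move=> y0 yd ydc; have [d0 _ _] := yd.
set p := 'X^d - c%:P.
have pm : p \is monic by exact: monicXnsubC.
have sp : size p = d.+1 by exact: size_XnsubC.
have rp (z : algC) : root (map_poly ratr p) z = (z ^+ d == ratr c).
  by rewrite /root rmorphB /= map_polyXn map_polyC /= !hornerE subr_eq0.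
have [n] := ubnP (size g); elim: n g => // n IH g sg gm groots.
have g0 := monic_neq0 gm.
have [s1|sn1] := eqVneq (size g) 1%N.
  exists 0%N; rewrite expr0 (size1_polyC (eq_leq s1)); congr (_%:P); move: gm.
  by rewrite monicE lead_coefE s1 => /eqP.
have /closed_rootP [z gz] : size (map_poly (ratr : rat -> algC) g) != 1%N.
  by rewrite size_map_poly.
have pz : root (map_poly ratr p) z by rewrite rp groots.
set h := gcdp g p.
have hg : h %| g by exact: dvdp_gcdl.
have hp : h %| p by exact: dvdp_gcdr.
have hz : root (map_poly ratr h) z by rewrite gcdp_map root_gcd gz pz.
have h0 : h != 0 by rewrite gcdp_eq0 negb_and g0.
have dh : (d %| (size h).-1)%N.
  apply: (dvdn_size_radical_roots y0 yd ydc h0) => w hw.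
  apply/eqP; rewrite -rp.
  by have /dvdpP[u ->] := hp; rewrite rmorphM /= rootM hw orbT.
have sh1 : (1 < size h)%N.
  rewrite -(size_map_poly (ratr : {rmorphism rat -> algC})).
  by apply: root_size_gt1 hz; rewrite map_poly_eq0.
have eh : h %= p.
  rewrite -dvdp_size_eqp // eqn_leq dvdp_leq ?monic_neq0 //= sp.
  by rewrite -(ltn_predK sh1) ltnS dvdn_leq // -ltnS (ltn_predK sh1).
have pg : p %| g by rewrite -(eqp_dvdl _ eh).
have gE : g = g %/ p * p by rewrite divpK.
have qm : g %/ p \is monic by rewrite -(monicMr _ pm) -gE.
have [||k kE] := IH (g %/ p) _ qm.
- rewrite -ltnS; apply: leq_trans sg.
  rewrite ltnS size_divp ?monic_neq0 // sp /=.
  by rewrite ltn_subrL d0 size_poly_gt0.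
- by move=> w qw; apply: groots; rewrite gE rmorphM /= rootM qw.
by exists k.+1; rewrite exprSr -kE.
Qed.

(** This is a polynomial in [X^d], and [d > 1] does not divide [d * k - 1]. *)
Lemma coef_XnsubC_exp_pred (A : idomainType) (c : A) (d k : nat) :
  (1 < d)%N -> (0 < k)%N -> (('X^d - c%:P) ^+ k)`_(d * k).-1 = 0.
Proof.
move=> d1 k0; have d0 := ltnW d1.
have -> : ('X^d - c%:P) ^+ k = (('X - c%:P) ^+ k) \Po 'X^d.
  by rewrite rmorphXn /= rmorphB /= comp_polyX comp_polyC.
rewrite coef_comp_poly_Xn // ifN //.
apply/negP => dv; have /(dvdn_sub (dvdn_mulr k (dvdnn d))) := dv.
rewrite -subn1 subKn ?muln_gt0 ?d0 //.
by rewrite dvdn1 => /eqP d1'; rewrite d1' in d1.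
Qed.

(** Every eigenvalue [z] of [M] satisfies [z ^+ d = c], so the characteristic polynomial is a power
    of [X^d - c]; its subleading coefficient, minus the trace, is zero. *)
Lemma mxtrace_radical (F : realFieldType) (y : F) (d n : nat) (c : rat)
    (M : 'M[rat]_n.+1) :
  0 < y -> radical_exponent y d -> (1 < d)%N -> y ^+ d = ratr c ->
  M ^+ d = c%:M -> \tr M = 0.
Proof.
move=> y0 yd d1 ydc Md; have d0 := ltnW d1.
have [z|k chiE] := radical_roots_power y0 yd ydc (char_poly_monic M).
  rewrite map_char_poly -eigenvalue_root_char => /eigenvalueP[v vM v0].
  have vMk k : v *m map_mx ratr M ^+ k = z ^+ k *: v.
    elim: k => [|k IH]; first by rewrite !expr0 mulmx1 scale1r.
    by rewrite exprS mulmxA vM -scalemxAl IH scalerA -exprS.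
  have := vMk d; rewrite -rmorphXn /= Md map_scalar_mx mul_mx_scalar.
  move/eqP; rewrite eq_sym -subr_eq0 -scalerBl scaler_eq0 (negPf v0) orbF.
  by rewrite subr_eq0 => /eqP.
have := congr1 predn (size_char_poly M).
rewrite chiE size_exp size_XnsubC //= => dk.
have k0 : (0 < k)%N by case: k dk {chiE} => //; rewrite muln0.
apply/eqP; rewrite -oppr_eq0 -char_poly_trace // chiE -dk.
by rewrite coef_XnsubC_exp_pred.
Qed.

(** * Rational spans stable under radicals, and linear independence *)

(** The rational span of the entries of [v] is closed under multiplication by [y], and [M]
    represents this action; the entries may be dependent. *)
Definition rat_stable (F : numFieldType) n (v : 'cV[F]_n) (y : F) : Prop :=
  exists M : 'M[rat]_n, y *: v = map_mx ratr M *m v.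

Definition rat_free (F : numFieldType) n (v : 'cV[F]_n) : Prop :=
  forall u : 'rV[rat]_n, map_mx ratr u *m v = 0 -> u = 0.

Lemma rat_free_mx (F : numFieldType) m n (v : 'cV[F]_n) (M : 'M[rat]_(m, n)) :
  rat_free v -> map_mx ratr M *m v = 0 -> M = 0.
Proof.
move=> vfree Mv; apply/row_matrixP => i; rewrite row0; apply: vfree.
by rewrite map_row -row_mul Mv row0.
Qed.

(* A rational relation on [v] lets [v] be compressed to a shorter stable vector,
   so a shortest one is free. *)
Lemma rat_free_stable_exists (F : numFieldType) (I : Type) (y : I -> F) n
    (v : 'cV[F]_n) :
  v != 0 -> (forall i, rat_stable v (y i)) ->
  exists m (w : 'cV[F]_m.+1), rat_free w /\ forall i, rat_stable w (y i).
Proof.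
elim/ltn_ind: n v => -[|n] IH v v0 vst.
  by case/negP: v0; apply/eqP/matrixP => -[].
have [vfree|] := EM (rat_free v); first by exists n, v.
move=> /existsNP[u] /not_implyP[uv /eqP u0].
have [j uj] : exists j, u 0 j != 0.
  apply/existsP; apply: contraNT u0 => /existsPn u0.
  by apply/eqP/rowP => j; rewrite mxE; apply/eqP; rewrite -[_ == _]negbK u0.
(* [P] fixes [v] because [u] annihilates it, yet [u *m P = 0], so [P] is singular. *)
pose P : 'M[rat]_n.+1 := 1%:M - delta_mx j 0 *m ((u 0 j)^-1 *: u).
have uP : u *m P = 0.
  rewrite mulmxBr mulmx1 mulmxA -colE -scalemxAr.
  apply/rowP => k; rewrite !mxE big_ord1 !mxE mulrA mulVf // mul1r.
  by rewrite subrr.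
have Pv : map_mx ratr P *m v = v.
  by rewrite map_mxB map_mx1 map_mxM map_mxZ mulmxBl mul1mx -mulmxA
    -scalemxAl uv scaler0 mulmx0 subr0.
have rP : (\rank P < n.+1)%N.
  rewrite ltn_neqAle rank_leq_row andbT; apply: contra_neqN u0 => Pfree.
  by apply/eqP; rewrite -(mulmx_free_eq0 _ (Pfree : row_free P)) uP.
(* Factor [P = C *m B] through its rank: [B] shortens [v], [C] recovers it, and [B *m M *m C]
   represents [y] on the shorter vector. *)
move: (mulmx_base P) rP.
move: (\rank P) (col_base P) (row_base P) => k C B CB kn.
have CBv : map_mx ratr C *m (map_mx ratr B *m v) = v.
  by rewrite mulmxA -map_mxM CB.
apply: (IH _ kn (map_mx ratr B *m v)).
  by apply: contra_neq v0 => Bv; rewrite -CBv Bv mulmx0.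
move=> i; have [M yM] := vst i; exists (B *m M *m C).
by rewrite !map_mxM -!mulmxA CBv -yM scalemxAr.
Qed.

(** Take for [v] all monomials in the [y i] with exponents below [b]. Multiplying by [y i] raises
    one exponent, or wraps it to 0 at the cost of the rational [y i ^+ b]. The monomial 1 makes [v]
    nonzero. *)
Lemma radicals_stable (F : numFieldType) (I : finType) (y : I -> F) (b : nat) :
  (0 < b)%N -> (forall i, is_rat (y i ^+ b)) ->
  exists n (v : 'cV[F]_n), v != 0 /\ forall i, rat_stable v (y i).
Proof.
case: b => // b _ yb.
pose T := {ffun I -> 'I_b.+1}.
pose mono (e : T) := \prod_i y i ^+ e i.
have step i (e : T) : exists q, exists e' : T, y i * mono e = ratr q * mono e'.
  have [q yq] := yb i.
  have rest (k : 'I_b.+1) : mono [ffun j => if j == i then k else e j] =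
      y i ^+ k * \prod_(j | j != i) y j ^+ e j.
    rewrite /mono (bigD1 i) //= ffunE eqxx; congr (_ * _).
    by apply: eq_bigr => j /negPf ji; rewrite ffunE ji.
  have -> : mono e = y i ^+ e i * \prod_(j | j != i) y j ^+ e j.
    by rewrite /mono (bigD1 i).
  have [eb|eb] := eqVneq (e i : nat) b.
    exists q, [ffun j => if j == i then 0 else e j].
    by rewrite rest expr0 mul1r mulrA -exprS eb yq.
  have lt : ((e i).+1 < b.+1)%N by rewrite ltnS ltn_neqAle eb -ltnS ltn_ord.
  exists 1, [ffun j => if j == i then Ordinal lt else e j].
  by rewrite rest rmorph1 mul1r mulrA -exprS.
exists #|T|, (\col_k mono (enum_val k)); split.
  apply/eqP => /colP /(_ (enum_rank [ffun=> 0])) /eqP.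
  rewrite !mxE enum_rankK /mono big1 ?oner_eq0 // => i _.
  by rewrite ffunE expr0.
move=> i; have [q qE] := choice (step i); have [e' eE] := choice qE.
exists (\matrix_(k, l)
  if l == enum_rank (e' (enum_val k)) then q (enum_val k) else 0).
apply/colP => k; rewrite !mxE eE (bigD1 (enum_rank (e' (enum_val k)))) //=.
rewrite !mxE eqxx enum_rankK big1 ?addr0 // => l /negPf lk.
by rewrite !mxE lk rmorph0 mul0r.
Qed.

(** On [v], [M ^+ d] acts as the rational [y ^+ d]; freeness turns this into an equality of
    matrices. *)
Lemma mxtrace_radical_stable (F : realFieldType) (y : F) (b n : nat)
    (v : 'cV[F]_n.+1) (M : 'M[rat]_n.+1) :
  0 < y -> (0 < b)%N -> is_rat (y ^+ b) -> ~ is_rat y -> rat_free v ->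
  y *: v = map_mx ratr M *m v -> \tr M = 0.
Proof.
move=> y0 b0 yb yirr vfree yM.
have [d yd] := radical_exponent_exists b0 yb.
have [d0 [c ydc] _] := yd.
have d1 : (1 < d)%N.
  rewrite ltn_neqAle d0 andbT; apply/eqP => d1.
  by case: yirr; exists c; rewrite -ydc -d1.
apply: (mxtrace_radical y0 yd d1 ydc); apply/eqP; rewrite -subr_eq0; apply/eqP.
apply: (rat_free_mx vfree).
have Mk k : map_mx ratr (M ^+ k) *m v = y ^+ k *: v.
  elim: k => [|k IH]; first by rewrite !expr0 map_mx1 mul1mx scale1r.
  by rewrite exprSr map_mxM -mulmxA -yM -scalemxAr IH scalerA -exprS.
by rewrite map_mxB mulmxBl Mk ydc map_scalar_mx mul_scalar_mx subrr.
Qed.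

Lemma radicals_rat_independent (F : realFieldType) (I : finType) (x : I -> F)
    (b : nat) (c : I -> rat) :
  (0 < b)%N -> (forall i, 0 < x i) ->
  (forall i j, is_rat ((x i / x j) ^+ b)) ->
  (forall i j, i != j -> ~ is_rat (x i / x j)) ->
  \sum_i ratr (c i) * x i = 0 -> forall i, c i = 0.
Proof.
move=> b0 x0 xb xirr rel j.
(* After division by [x j], the ratios act by matrices [M i] with [M j = 1]; the trace of the
   relation leaves only [c j] times the dimension. *)
have [n0 [v0 [v0n0 v0st]]] := radicals_stable b0 (xb^~ j).
have [n [v [vfree /choice[M yM]]]] := rat_free_stable_exists v0n0 v0st.
have sM : \sum_i c i *: M i = 0.
  apply: (rat_free_mx vfree).
  rewrite raddf_sum mulmx_suml /=.
  rewrite (eq_bigr (fun i => (ratr (c i) * x i) *: ((x j)^-1 *: v))).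
    by rewrite -scaler_suml rel scale0r.
  by move=> i _; rewrite map_mxZ -scalemxAl -yM !scalerA mulrA.
have := congr1 mxtrace sM; rewrite raddf_sum mxtrace0 (bigD1 j) //= big1 ?addr0.
  have -> : M j = 1%:M.
    apply/eqP; rewrite -subr_eq0; apply/eqP; apply: (rat_free_mx vfree).
    rewrite map_mxB mulmxBl -yM map_mx1 mul1mx divff ?gt_eqF //.
    by rewrite scale1r subrr.
  by move/eqP; rewrite mxtraceZ mxtrace1 mulf_eq0 pnatr_eq0 orbF => /eqP.
move=> i ij; rewrite mxtraceZ.
have yij : 0 < x i / x j by rewrite divr_gt0.
have irr := xirr i j ij.
by rewrite (mxtrace_radical_stable yij b0 (xb i j) irr vfree (yM i)) mulr0.
Qed.

(** * Valuations and radicals of primes *)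

(** At [p] the valuations give [k + b * logn p m = b * logn p n]. *)
Lemma prime_power_ratio_dvd (p q k b m n : nat) :
  prime p -> prime q -> p != q -> (0 < m)%N -> (0 < n)%N ->
  (p ^ k * m ^ b = q ^ k * n ^ b)%N -> (b %| k)%N.
Proof.
move=> pp pq pNq m0 n0 /(congr1 (logn p)).
rewrite !lognM ?expn_gt0 ?m0 ?n0 ?(prime_gt0 pp) ?(prime_gt0 pq) // !lognX.
rewrite !(logn_prime _ pp) !(logn_prime _ pq) eqxx muln1 (negPf pNq) muln0.
rewrite add0n => E.
by rewrite -(dvdn_addl _ (dvdn_mulr (logn p m) (dvdnn b))) E dvdn_mulr.
Qed.

Lemma prime_ratio_expr_dvd (p q b : nat) (a : int) (t : rat) :
  (0 < b)%N -> prime p -> prime q -> p != q ->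
  t ^+ b = (p%:R / q%:R) ^ a -> (b %| `|a|)%N.
Proof.
(* A negative exponent becomes positive on exchanging [p] and [q]. *)
wlog [k ->] : p q a / exists k : nat, a = k.
  move=> IH b0 pp pq pNq; case: a => k; first by apply: IH => //; exists k.
  rewrite NegzE => E; rewrite abszN; apply: (IH q p) => //; first by exists k.+1.
    by rewrite eq_sym.
  by rewrite E -exprz_inv invf_div.
move=> b0 pp pq pNq E.
have [p0 q0] : (p%:R != 0 :> rat) /\ (q%:R != 0 :> rat).
  by rewrite !pnatr_eq0 -!lt0n !prime_gt0.
have t0 : t != 0.
  have : t ^+ b != 0 by rewrite E expf_neq0 // mulf_neq0 // invr_eq0.
  by rewrite expf_eq0 b0.
have tE : `|t| = `|numq t|%N%:R / `|denq t|%N%:R.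
  by rewrite -{1}(divq_num_den t) normf_div -!intr_norm !natr_absz.
have nE : `|t| ^+ b = p%:R ^+ k / q%:R ^+ k.
  by rewrite -normrX E -exprnP ger0_norm ?exprn_ge0 ?divr_ge0 // expr_div_n.
have d0 : (0 < `|denq t|)%N by rewrite absz_gt0 denq_eq0.
have n0 : (0 < `|numq t|)%N by rewrite absz_gt0 numq_eq0.
apply: (prime_power_ratio_dvd pp pq pNq d0 n0).
apply/eqP; rewrite -(eqr_nat rat) !natrM !natrX.
move: nE; rewrite tE expr_div_n => /eqP.
rewrite eqr_div ?expf_neq0 // ?pnatr_eq0 -?lt0n // => /eqP nE.
by rewrite -nE mulrC.
Qed.

Lemma powR_ratr_exp_denq (R : realType) (x : R) (r : rat) :
  0 <= x -> (x `^ ratr r) ^+ `|denq r| = x ^ numq r.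
Proof.
move=> x0; rewrite -powR_mulrn ?powR_ge0 // -powRrM -powR_intmul //.
by rewrite natr_absz gtr0_norm ?denq_gt0 // /ratr divfK // intr_eq0 denq_eq0.
Qed.

Lemma powR_ratr_ratio (R : realType) (p q : nat) (r : rat) :
  ((p%:R `^ ratr r : R) / (q%:R `^ ratr r)) ^+ `|denq r| =
  ratr ((p%:R / q%:R) ^ numq r).
Proof.
rewrite expr_div_n !powR_ratr_exp_denq //.
by rewrite fmorphXz /= fmorph_div /= !ratr_nat expfzMl exprz_inv invr_expz.
Qed.

Lemma prime_powR_independent (R : realType) (r : rat) (s : seq nat)
    (c : nat -> rat) :
  r \isn't a Num.int -> uniq s -> {in s, forall p, prime p} ->
  \sum_(p <- s) ratr (c p) * p%:R `^ (ratr r : R) = 0 ->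
  {in s, forall p, c p = 0}.
Proof.
move=> rint us sprime rel.
have b0 : (0 < `|denq r|)%N by rewrite absz_gt0 denq_eq0.
pose P (i : 'I_(size s)) := tnth (in_tuple s) i.
have Pp i : prime (P i) by apply: sprime; exact: mem_tnth.
rewrite big_tnth in rel.
suff cP i : c (P i) = 0 by move=> p /(tnthP (in_tuple s))[i ->].
apply: (radicals_rat_independent b0 _ _ _ rel) => [j|j k|j k jk [t tE]].
- by rewrite powR_gt0 // ltr0n prime_gt0.
- by eexists; exact: powR_ratr_ratio.
have PjNk : P j != P k.
  by rewrite /P !(tnth_nth 0%N) nth_uniq.
have E : t ^+ `|denq r| = ((P j)%:R / (P k)%:R) ^ numq r.
  apply: (fmorph_inj (ratr : {rmorphism rat -> R})).
  by rewrite rmorphXn /= -tE powR_ratr_ratio.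
have dvd := prime_ratio_expr_dvd b0 (Pp j) (Pp k) PjNk E.
(* The denominator divides the coprime numerator, hence is 1, and [r] would be an integer. *)
have := coprime_num_den r; rewrite /coprime (gcdn_idPr dvd) => /eqP d1.
by move: rint; rewrite Qint_def -[denq r]gtz0_abs ?denq_gt0 // d1.
Qed.

(** * Ties at consecutive integers *)

Lemma primes_prime (n p : nat) : p \in primes n -> prime p.
Proof. by rewrite mem_primes => /andP[]. Qed.

(** Primes of [m] have valuation 0 in [n]; this puts [f r n] and [f r n.+1] over one common list. *)
Lemma sum_primes_cat (R : realType) (r : R) (n m : nat) :
  coprime n m ->
  \sum_(p <- primes n ++ primes m) (logn p n)%:R * p%:R `^ r = f r n.
Proof.
move=> nm; rewrite big_cat /= [X in _ + X]big1_seq ?addr0 //= => p.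
rewrite mem_primes => /and3P[pp m0 pm].
rewrite lognE; case: and3P => [[_ n0 pn]|]; last by rewrite mul0r.
have : (p %| 1)%N by rewrite -(eqP nm) dvdn_gcd pn.
by rewrite dvdn1 => /eqP p1; rewrite p1 in pp.
Qed.

Theorem theorem1p2 (R : realType) (r : rat) (hr : r \isn't a Num.int) :
  (~ exists n : nat, (0 < n)%N /\ f (ratr r : R) n = f (ratr r : R) n.+1) /\
  (forall x : R, count_ties (ratr r : R) x = 0%N).
Proof.
have noties n : (0 < n)%N -> f (ratr r : R) n <> f (ratr r : R) n.+1.
  move=> n0 fE.
  pose s := primes n ++ primes n.+1.
  have disj : ~~ has (in_mem^~ (mem (primes n))) (primes n.+1).
    by rewrite -coprime_has_primes // coprimenS.
  have us : uniq s by rewrite cat_uniq !primes_uniq disj.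
  have sprime : {in s, forall p, prime p}.
    by move=> p; rewrite mem_cat => /orP[] /primes_prime.
  have sC : perm_eq s (primes n.+1 ++ primes n) by rewrite /s perm_catC.
  pose c p : rat := (logn p n)%:R - (logn p n.+1)%:R.
  have rel : \sum_(p <- s) ratr (c p) * p%:R `^ (ratr r : R) = 0.
    under eq_bigr do rewrite rmorphB /= !ratr_nat mulrBl.
    rewrite sumrB (sum_primes_cat _ (coprimenS n)) (perm_big _ sC).
    by rewrite (sum_primes_cat _ (coprimeSn n)) fE subrr.
  (* Since [n.+1 > 1], it has a prime divisor; that prime does not divide [n], so its coefficient
     [c] is nonzero. *)
  have p1 := pdiv_prime (n0 : (1 < n.+1)%N).
  have pn1 : pdiv n.+1 \in primes n.+1 by rewrite mem_primes p1 pdiv_dvd.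
  have pn : pdiv n.+1 \notin primes n.
    by apply: contra disj => pn; apply/hasP; exists (pdiv n.+1).
  have sn1 : pdiv n.+1 \in s by rewrite mem_cat pn1 orbT.
  have /eqP := prime_powR_independent hr us sprime rel sn1.
  rewrite subr_eq0 eqr_nat.
  have -> : logn (pdiv n.+1) n = 0%N.
    by apply/eqP; rewrite -leqn0 leqNgt logn_gt0.
  by rewrite eq_sym -leqn0 leqNgt logn_gt0 pn1.
split=> [[n [n0]]|x]; first exact: noties.
apply/eqP; rewrite -leqn0 leqNgt -has_count; apply/hasPn => n.
by rewrite mem_iota => /andP[n0 _]; apply/eqP/noties.
Qed.
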